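(* Let $n\ge 1$, and let $f:\{0,1\}^n\to\{0,1\}$ be any function in $F_{DJ}^{\otimes}$, i.e. $f(x)=(a\cdot x)\oplus c$ for some $a\in\{0,1\}^n$ and $c\in\{0,1\}$. Then entanglement is never generated when the Deutsch-Jozsa algorithm is executed on $f$: each of the $(n+1)$-qubit states $|\psi_0\rangle,|\psi_1\rangle,|\psi_2\rangle,|\psi_3\rangle$ occurring in the execution on $f$ is separable.
   Context: For $a,x\in\{0,1\}^n$, $a\cdot x=\sum_i a_ix_i \bmod 2$, and $\oplus$ is addition modulo 2. $F_{DJ}^{\otimes}$ is the set of all Boolean functions $f:\{0,1\}^n\to\{0,1\}$ of the form $f(x)=(a\cdot x)\oplus c$ with $a\in\{0,1\}^n$, $c\in\{0,1\}$. A pure state of $m$ qubits (unit vector in $(\mathbb{C}^2)^{\otimes m}$) is separable if it is a tensor product of $m$ single-qubit states; otherwise it is entangled. The quantum oracle of $f$ is the unitary $U_f$ on $n+1$ qubits with $U_f|x\rangle|y\rangle=|x\rangle|y\oplus f(x)\rangle$. Let $H$ be the Hadamard gate and $|-\rangle=(|0\rangle-|1\rangle)/\sqrt2$. The Deutsch-Jozsa algorithm on $f$ passes through the following states: $|\psi_0\rangle=|0\rangle^{\otimes n}|1\rangle$ (initial state); $|\psi_1\rangle=\frac{1}{\sqrt{2^n}}\sum_{x\in\{0,1\}^n}|x\rangle|-\rangle$ (after applying $H$ to all $n+1$ qubits); $|\psi_2\rangle=U_f|\psi_1\rangle=\frac{1}{\sqrt{2^n}}\sum_{x\in\{0,1\}^n}(-1)^{f(x)}|x\rangle|-\rangle$;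 $|\psi_3\rangle=\frac{1}{2^n}\sum_{z\in\{0,1\}^n}\sum_{x\in\{0,1\}^n}(-1)^{x\cdot z+f(x)}|z\rangle|-\rangle$ (after applying $H$ to each of the first $n$ qubits). *)

(* Defs.v *)
From mathcomp Require Import all_boot all_order all_algebra.
From mathcomp Require Import reals complex.

Set Implicit Arguments.
Unset Strict Implicit.
Unset Printing Implicit Defensive.

Import GRing.Theory Num.Theory.
Local Open Scope ring_scope.
Local Open Scope complex_scope.

Definition bits (m : nat) := {ffun 'I_m -> bool}.

Definition dotb (n : nat) (a x : bits n) : bool :=
  \big[addb/false]_(i < n) (a i && x i).

Definition F_DJ_tensor (n : nat) (f : bits n -> bool) : Prop :=
  exists (a : bits n) (c : bool), forall x, f x = dotb a x (+) c.

(* [psi x] is the amplitude of |x>.  The scaling on [{ffun _ -> V}] requires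
   an Lmodule [V], hence the [^o]. *)
Definition qvect (R : realType) (m : nat) := {ffun bits m -> R[i]^o}.

Definition qubit (R : realType) := {ffun bool -> R[i]^o}.

Definition pure_state (R : realType) (m : nat) (psi : qvect R m) : Prop :=
  \sum_(x : bits m) `|psi x| ^+ 2 = 1.

Definition qubit_state (R : realType) (v : qubit R) : Prop :=
  \sum_(b : bool) `|v b| ^+ 2 = 1.

Definition tensor (R : realType) (m : nat) (v : 'I_m -> qubit R) : qvect R m :=
  [ffun x : bits m => \prod_(i < m) v i (x i)].

Definition separable (R : realType) (m : nat) (psi : qvect R m) : Prop :=
  pure_state psi /\
  exists v : 'I_m -> qubit R,
    (forall i, qubit_state (v i)) /\ psi = tensor v.

Definition ket (R : realType) (m : nat) (x : bits m) : qvect R m :=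
  [ffun z : bits m => (z == x)%:R].

(* The ancilla |y> is the last qubit, of index [ord_max]; the [i]-th qubit of
   |x> has index [lift ord_max i], whose value is that of [i]. *)
Definition join (n : nat) (x : bits n) (y : bool) : bits n.+1 :=
  [ffun i => if unlift ord_max i is Some j then x j else y].

Definition data (n : nat) (z : bits n.+1) : bits n :=
  [ffun i => z (lift ord_max i)].

Definition ancilla (n : nat) (z : bits n.+1) : bool := z ord_max.

(* phi (x) v, for [phi] on the first [n] qubits and [v] on the ancilla *)
Definition with_ancilla (R : realType) (n : nat) (phi : qvect R n)
    (v : qubit R) : qvect R n.+1 :=
  [ffun z : bits n.+1 => phi (data z) * v (ancilla z)].

(* [G b b'] is the matrix entry <b|G|b'>. *)
Definition gate (R : realType) := bool -> bool -> R[i].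

Definition id_gate (R : realType) : gate R := fun b b' => (b == b')%:R.

Definition hadamard (R : realType) : gate R :=
  fun b b' => ((Num.sqrt 2)^-1 : R)%:C * (-1) ^+ (b && b').

(* the operator G_0 (x) ... (x) G_(m-1) *)
Definition apply_gates (R : realType) (m : nat) (G : 'I_m -> gate R)
    (psi : qvect R m) : qvect R m :=
  [ffun z : bits m => \sum_(x : bits m) (\prod_(i < m) G i (z i) (x i)) * psi x].

(* the linear extension of |x>|y> |-> |x>|y (+) f x> *)
Definition oracle (R : realType) (n : nat) (f : bits n -> bool)
    (psi : qvect R n.+1) : qvect R n.+1 :=
  \sum_(x : bits n) \sum_(y : bool) psi (join x y) *: ket R (join x (y (+) f x)).

Definition psi0 (R : realType) (n : nat) : qvect R n.+1 :=
  ket R (join [ffun=> false] true).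

Definition psi1 (R : realType) (n : nat) : qvect R n.+1 :=
  apply_gates (fun=> hadamard R) (psi0 R n).

Definition psi2 (R : realType) (n : nat) (f : bits n -> bool) : qvect R n.+1 :=
  oracle f (psi1 R n).

Definition psi3 (R : realType) (n : nat) (f : bits n -> bool) : qvect R n.+1 :=
  apply_gates (fun i => if i == ord_max then id_gate R else hadamard R)
    (psi2 R f).

Definition ket_minus (R : realType) : qubit R :=
  [ffun b : bool => ((Num.sqrt 2)^-1 : R)%:C * (-1) ^+ b].

Section ClosedForms.
Variables (R : realType) (n : nat).
Implicit Types (x : bits n) (y : bool) (z : bits n.+1) (f : bits n -> bool).

Lemma data_join x y : data (join x y) = x.
Proof. by apply/ffunP => i; rewrite !ffunE liftK. Qed.

Lemma ancilla_join x y : ancilla (join x y) = y.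
Proof. by rewrite /ancilla ffunE unlift_none. Qed.

Lemma join_data z : join (data z) (ancilla z) = z.
Proof.
apply/ffunP => i; rewrite ffunE.
by case: unliftP => [j|] ->; rewrite ?ffunE.
Qed.

Lemma join_eq z x y : (z == join x y) = (data z == x) && (ancilla z == y).
Proof.
apply/eqP/andP => [->|[/eqP <- /eqP <-]]; last by rewrite join_data.
by rewrite data_join ancilla_join.
Qed.

Lemma lift_max_neq (i : 'I_n) : (lift ord_max i == ord_max) = false.
Proof. by rewrite eq_sym (negbTE (neq_lift _ _)). Qed.

Lemma prod_max (F : 'I_n.+1 -> R[i]) :
  \prod_(i < n.+1) F i = (\prod_(i < n) F (lift ord_max i)) * F ord_max.
Proof.
rewrite big_ord_recr /=; congr (_ * _); apply: eq_bigr => i _.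
by congr F; apply: val_inj; rewrite /= /bump leqNgt ltn_ord.
Qed.

Lemma sum_join (F : bits n.+1 -> R[i]) :
  \sum_z F z = \sum_x \sum_y F (join x y).
Proof.
rewrite pair_bigA /= (reindex (fun p : bits n * bool => join p.1 p.2)) //=.
exists (fun z => (data z, ancilla z)) => [[x y] _|z _] /=.
  by rewrite data_join ancilla_join.
exact: join_data.
Qed.

Lemma oracleE f (psi : qvect R n.+1) z :
  oracle f psi z = psi (join (data z) (ancilla z (+) f (data z))).
Proof.
rewrite sum_ffunE (bigD1 (data z)) //= [X in _ + X]big1 ?addr0 => [|x xz].
  rewrite sum_ffunE (bigD1 (ancilla z (+) f (data z))) //= big1 ?addr0 => [|y yz].
    by rewrite !ffunE join_eq addbK !eqxx /= [RHS](esym (mulr1 _)).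
  rewrite !ffunE join_eq eqxx /= (_ : _ == _ = false) ?scaler0 //.
  by apply/eqP => e; case/eqP: yz; rewrite e addbK.
rewrite sum_ffunE big1 // => y _.
by rewrite !ffunE join_eq eq_sym (negbTE xz) scaler0.
Qed.

Lemma oracle_ket f x y :
  oracle f (ket R (join x y)) = ket R (join x (y (+) f x)).
Proof.
apply/ffunP => z; rewrite oracleE !ffunE !join_eq data_join ancilla_join.
case: eqP => //= ->; congr ((_ : bool)%:R).
by rewrite -(inj_eq (can_inj (addbK (f x)))) addbK.
Qed.

Lemma hadamard_prod x x' :
  \prod_(i < n) hadamard R (x i) (x' i) =
  ((Num.sqrt (2 ^+ n))^-1 : R)%:C * (-1) ^+ dotb x x'.
Proof.
rewrite big_split /= prodr_const card_ord -rmorphXn /= exprVn.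
congr (_^-1%:C * _).
  apply: (@pexpIrn _ 2) => //; rewrite ?nnegrE ?exprn_ge0 ?sqrtr_ge0 //.
  by rewrite sqr_sqrtr ?exprn_ge0 ?ler0n // exprAC sqr_sqrtr ?ler0n.
rewrite /dotb; elim/big_rec2: _ => [|i e b _ ->] //=.
by rewrite signr_addb.
Qed.

Lemma ketE x (F : bits n -> R[i]^o) :
  (\sum_x' F x' *: ket R x') x = F x.
Proof.
rewrite sum_ffunE (bigD1 x) //= big1 ?addr0 => [|x' xx'].
  by rewrite !ffunE eqxx [LHS]mulr1.
by rewrite !ffunE eq_sym (negbTE xx') scaler0.
Qed.

Lemma psi1E :
  psi1 R n =
  with_ancilla (((Num.sqrt (2 ^+ n))^-1 : R)%:C *: \sum_x ket R x)
               (ket_minus R).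
Proof.
apply/ffunP => z; rewrite !ffunE (bigD1 (join [ffun=> false] true)) //=.
rewrite [X in _ + X]big1 ?addr0 => [|w wz]; last first.
  by rewrite ffunE (negbTE wz) mulr0.
rewrite ffunE eqxx mulr1 prod_max.
rewrite (eq_bigr (fun i => hadamard R (data z i) (([ffun=> false] : bits n) i)));
  last by move=> i _; rewrite !ffunE liftK ffunE.
rewrite hadamard_prod ffunE unlift_none /hadamard andbT.
rewrite (_ : dotb _ _ = false) ?mulr1; last first.
  by rewrite /dotb big1 // => i _; rewrite !ffunE andbF.
congr (_ * _).
rewrite (eq_bigr (fun x => (1 : R[i]) *: ket R x)); last first.
  by move=> x _; rewrite scale1r.
by rewrite ketE [RHS]mulr1.
Qed.

Lemma psi2E f :
  psi2 R f =
  with_ancilla (((Num.sqrt (2 ^+ n))^-1 : R)%:C *: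
                  \sum_x ((-1) ^+ f x : R[i]) *: ket R x)
               (ket_minus R).
Proof.
apply/ffunP => z; rewrite /psi2 oracleE psi1E !ffunE data_join ancilla_join.
rewrite ketE signr_addb.
rewrite (eq_bigr (fun x => (1 : R[i]) *: ket R x)); last first.
  by move=> x _; rewrite scale1r.
rewrite ketE [_ *: 1]mulr1.
suff E (u v s t : R[i]) : u * (v * (s * t)) = u * t * (v * s) by exact: E.
by rewrite (mulrC s) mulrA mulrACA.
Qed.

Lemma psi3E f :
  psi3 R f =
  with_ancilla (((2 ^+ n)^-1 : R[i]) *:
                  \sum_w \sum_x ((-1) ^+ (dotb x w + f x) : R[i]) *: ket R w)
               (ket_minus R).
Proof.
apply/ffunP => z; rewrite /psi3 psi2E !ffunE sum_join.
under [in RHS]eq_bigr do rewrite -scaler_suml.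
rewrite ketE.
transitivity (\sum_x (((Num.sqrt (2 ^+ n))^-1 : R)%:C ^+ 2 *
    (-1) ^+ (dotb x (data z) + f x)) * ket_minus R (ancilla z)).
  apply: eq_bigr => x _; rewrite (bigD1 (ancilla z)) //=.
  rewrite [X in _ + X]big1 ?addr0 => [|y yz]; last first.
    rewrite prod_max eqxx /id_gate -/(ancilla _) -/(ancilla _) ancilla_join.
    by rewrite eq_sym (negbTE yz) mulr0 mul0r.
  rewrite prod_max eqxx /id_gate -/(ancilla _) -/(ancilla _) ancilla_join.
  rewrite eqxx mulr1 !ffunE data_join ancilla_join ketE.
  rewrite (eq_bigr (fun i => hadamard R (data z i) (x i))); last first.
    by move=> i _; rewrite lift_max_neq !ffunE liftK.
  rewrite hadamard_prod.
  rewrite (_ : dotb (data z) x = dotb x (data z)); last first.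
    by apply: eq_bigr => i _; rewrite andbC.
  rewrite exprD.
  suff E (u v s t : R[i]) : u * s * (u * t * v) = u ^+ 2 * (s * t) * v
    by exact: E.
  by rewrite mulrA mulrACA.
rewrite -mulr_suml -mulr_sumr; congr (_ * _ * _).
rewrite -rmorphXn /= exprVn sqr_sqrtr ?exprn_ge0 ?ler0n //.
by rewrite fmorphV rmorphXn /= rmorph_nat.
by rewrite ffunE.
Qed.

End ClosedForms.

(* Main.v *)
Require Import Defs.
From mathcomp Require Import all_boot all_order all_algebra.
From mathcomp Require Import reals complex.
From mathcomp Require Import ring.

(** Every gate of the circuit other than the oracle acts qubitwise, so it maps
  product states to product states.  The oracle is entangling in general, but
  here the ancilla is in an eigenstate of X with eigenvalue -1, so the oracle
  multiplies the amplitude at x by (-1)^(f x); for f x = a.x (+) c this phase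
  factors as (-1)^c times the product of the single-qubit phases
  (-1)^(a_i x_i). *)

Set Implicit Arguments.
Unset Strict Implicit.
Unset Printing Implicit Defensive.

Import GRing.Theory Num.Theory.
Local Open Scope ring_scope.
Local Open Scope complex_scope.

Section ProductStates.
Variable R : realType.

Definition apply_gate (G : gate R) (v : qubit R) : qubit R :=
  [ffun b => \sum_(b' : bool) G b b' * v b'].

Definition gate_isometry (G : gate R) : Prop :=
  forall v, qubit_state v -> qubit_state (apply_gate G v).

Definition basis_qubit (b : bool) : qubit R := [ffun b' => (b' == b)%:R].

(** The diagonal gate with entries [(-1) ^+ p b], applied to [v]. *)
Definition phase_qubit (p : bool -> bool) (v : qubit R) : qubit R :=
  [ffun b => (-1) ^+ p b * (v b : R[i])].

Lemma qubit_state_basis b : qubit_state (basis_qubit b).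
Proof.
rewrite /qubit_state big_bool !ffunE.
by case: b; rewrite /= normr0 normr1 expr0n expr1n ?addr0 ?add0r.
Qed.

Lemma qubit_state_phase p v : qubit_state v -> qubit_state (phase_qubit p v).
Proof.
rewrite /qubit_state => <-; apply: eq_bigr => b _.
by rewrite ffunE normrM normrX normrN1 expr1n mul1r.
Qed.

Lemma id_gate_isometry : gate_isometry (id_gate R).
Proof.
move=> v; rewrite /qubit_state => <-; apply: eq_bigr => b _.
rewrite ffunE big_bool /id_gate.
by case: b; rewrite /= mul1r mul0r ?addr0 ?add0r.
Qed.

(** The parallelogram law: |y - x|^2 + |y + x|^2 = 2(|x|^2 + |y|^2), and the squared scalar 1/2
    cancels the 2. *)
Lemma hadamard_isometry : gate_isometry (hadamard R).
Proof.
move=> v; rewrite /qubit_state !big_bool !ffunE !big_bool /hadamard /=.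
move: (v true : R[i]) (v false : R[i]) => x y hxy.
set s : R[i] := (_^-1)%:C.
have s2 : `|s| ^+ 2 = 2^-1.
  rewrite ger0_norm; last by rewrite ler0c invr_ge0 sqrtr_ge0.
  by rewrite -rmorphXn /= exprVn sqr_sqrtr ?ler0n // fmorphV rmorph_nat.
have -> : s * (-1) ^+ 1 * x + s * (-1) ^+ 0 * y = s * (y - x) by ring.
have -> : s * (-1) ^+ 0 * x + s * (-1) ^+ 0 * y = s * (y + x) by ring.
(* Writing |u|^2 as u times its conjugate leaves a polynomial identity in x, y and their
   conjugates. *)
rewrite -hxy !normrM !exprMn s2 !normCK !rmorphB !rmorphD /=.
by field.
Qed.

Lemma sum_prod_bits m (F : 'I_m -> bool -> R[i]) :
  \sum_(x : bits m) \prod_(i < m) F i (x i) = \prod_(i < m) \sum_b F i b.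
Proof. by rewrite bigA_distr_bigA. Qed.

(** By distributivity the squared norm of a product state is the product of the squared norms of its
    factors, all equal to 1. *)
Lemma separable_tensor m (v : 'I_m -> qubit R) :
  (forall i, qubit_state (v i)) -> separable (tensor v).
Proof.
move=> hv; split; last by exists v.
rewrite /pure_state.
under eq_bigr do rewrite ffunE normr_prod -prodrXl.
rewrite (sum_prod_bits (fun i b => `|v i b| ^+ 2)).
by rewrite big1 // => i _; apply: hv.
Qed.

Lemma ket_tensor m (x : bits m) : ket R x = tensor (fun i => basis_qubit (x i)).
Proof.
apply/ffunP => z; rewrite !ffunE.
under eq_bigr do rewrite ffunE.
have [->|/eqP zx] := eqVneq z x.
  by rewrite big1 // => i _; rewrite eqxx.
(* A position where the bit strings differ contributes a zero factor. *)
have [i zxi] : exists i, z i != x i.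
  apply/existsP; apply: contra_notT zx => /existsPn h.
  by apply/ffunP => i; apply/eqP; have := h i; rewrite negbK.
by rewrite (bigD1 i) //= (negbTE zxi) mul0r.
Qed.

Lemma apply_gates_tensor m (G : 'I_m -> gate R) (v : 'I_m -> qubit R) :
  apply_gates G (tensor v) = tensor (fun i => apply_gate (G i) (v i)).
Proof.
apply/ffunP => z; rewrite !ffunE.
under eq_bigr do rewrite ffunE -big_split.
rewrite (sum_prod_bits (fun i b => G i (z i) b * v i b)).
by apply: eq_bigr => i _; rewrite ffunE.
Qed.

Lemma sign_dotb n (a x : bits n) :
  (-1) ^+ dotb a x = \prod_(i < n) (-1) ^+ (a i && x i) :> R[i].
Proof.
by rewrite /dotb; elim/big_rec2: _ => [|i e b _ <-] //; rewrite signr_addb.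
Qed.

(** Data qubit j carries the exponent a_j b; the ancilla carries the global sign (-1)^c, whatever
    its bit. *)
Definition affine_phase n (a : bits n) (c : bool) (i : 'I_n.+1) (b : bool) :=
  if unlift ord_max i is Some j then a j && b else c.

Lemma oracle_tensor n (f : bits n -> bool) (a : bits n) (c : bool)
    (v : 'I_n.+1 -> qubit R) :
  (forall x, f x = dotb a x (+) c) ->
  v ord_max true = - v ord_max false ->
  oracle f (tensor v) = tensor (fun i => phase_qubit (affine_phase a c i) (v i)).
Proof.
move=> hf hv; apply/ffunP => z; rewrite oracleE !ffunE !prod_max.
rewrite [join _ _ ord_max](ancilla_join (data z)) ffunE.
(* Phase kickback: by [hv], shifting the ancilla bit by y costs the sign (-1)^y; it is used with y =
   f(x). *)
have -> y b : v ord_max (b (+) y) = (-1) ^+ y * (v ord_max b : R[i]).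
  by case: y b => [] []; rewrite /= ?expr0 ?expr1 ?mul1r ?mulN1r // hv ?opprK.
under [in RHS]eq_bigr do rewrite ffunE /affine_phase liftK.
rewrite big_split /= /affine_phase unlift_none hf signr_addb sign_dotb.
under eq_bigr do rewrite ffunE liftK ffunE.
under [X in _ * (X * _ * _) = _]eq_bigr do rewrite ffunE.
by rewrite /ancilla; ring.
Qed.

End ProductStates.

Theorem proposition2p3 (R : realType) (n : nat) (hn : (1 <= n)%N)
    (f : bits n -> bool) (hf : F_DJ_tensor f) :
  [/\ separable (psi0 R n), separable (psi1 R n),
      separable (psi2 R f) & separable (psi3 R f)].
Proof.
have [a [c hac]] := hf.
pose v0 (i : 'I_n.+1) := basis_qubit R (join [ffun=> false] true i).
pose v1 i := apply_gate (hadamard R) (v0 i).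
pose v2 i := phase_qubit (affine_phase a c i) (v1 i).
have q0 i : qubit_state (v0 i) by apply: qubit_state_basis.
have q1 i : qubit_state (v1 i) by apply: hadamard_isometry.
have q2 i : qubit_state (v2 i) by apply: qubit_state_phase.
have e0 : psi0 R n = tensor v0 by apply: ket_tensor.
have e1 : psi1 R n = tensor v1 by rewrite /psi1 e0 apply_gates_tensor.
have e2 : psi2 R f = tensor v2.
  rewrite /psi2 e1; apply: oracle_tensor => //.
  (* The ancilla starts in |1>, which Hadamard sends to |->, whose two amplitudes are opposite. *)
  rewrite /v1 /v0 [join _ _ ord_max]ancilla_join !ffunE !big_bool !ffunE.
  by rewrite /hadamard /=; ring.
split; [rewrite e0|rewrite e1|rewrite e2|rewrite /psi3 e2 apply_gates_tensor];
  apply: separable_tensor => // i.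
(* Only [psi3] is left: identity on the ancilla, Hadamard on each data qubit. *)
by case: ifP => _; [apply: id_gate_isometry|apply: hadamard_isometry].
Qed.
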